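(* Suppose that $\rho=0$ or $\mu^{\otimes(m\times n)}(\mathcal T_\rho(\mathbf r,\mathbf c))=0$, and that $\nu$ is $\sigma$-finite. For $\nu$-almost all margins $(\mathbf r,\mathbf c)$ with an MLE $(\boldsymbol\alpha,\boldsymbol\beta)$, the following hold: (i) Let $X\sim\lambda_{\mathbf r,\mathbf c}$ and let $Y\sim\mu_{\boldsymbol\alpha\oplus\boldsymbol\beta}$. Then $X$ has the same distribution as $Y$ conditional on $Y\in\mathcal T(\mathbf r,\mathbf c)$. (ii) Let $\nu_{\overline{\mathbf y}}(\cdot)$ denote the law of $(r(Y),c(Y))$ given $\overline Y=\overline{\mathbf y}$ and let $p_{\overline{\mathbf y}}(\cdot)$ denote the Radon–Nikodym derivative of $\nu_{\overline{\mathbf y}}$ with respect to the unconditional law $\nu_Y$ of $(r(Y),c(Y))$. Then for each bounded measurable function $h:\mathbb R^{(m-1)\times(n-1)}\to\mathbb R$, $$\mathbb E[h(\overline X)]=\mathbb E\big[p_{\overline Y}(\mathbf r,\mathbf c)\,h(\overline Y)\big]\le\Big(\sup_{\overline{\mathbf y}}p_{\overline{\mathbf y}}(\mathbf r,\mathbf c)\Big)\,\mathbb E[h(\overline Y)].$$ Furthermore, if $\overline{\mathbf y}\mapsto p_{\overline{\mathbf y}}(\mathbf r,\mathbf c)$ is proportional to some function $\overline{\mathbf y}\mapsto q_{\overline{\mathbf y}}(\mathbf r,\mathbf c)$, then $$\sup_{\overline{\mathbf y}}p_{\overline{\mathbf y}}(\mathbf r,\mathbf c)=\Big(\sup_{\overline{\mathbf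 y}}q_{\overline{\mathbf y}}(\mathbf r,\mathbf c)\Big)\,\mathbb E[q_{\overline Y}(\mathbf r,\mathbf c)]^{-1}.$$
   Context: Let $\mu$ be a $\sigma$-finite Borel measure on $\mathbb R$, $A=\inf\operatorname{supp}\mu$, $B=\sup\operatorname{supp}\mu$ (possibly infinite). Let $\Theta=\{\theta\in\mathbb R:\int e^{\theta x}\mu(dx)<\infty\}$, assumed nonempty and not a singleton, with interior $\Theta^\circ$; $\psi(\theta)=\log\int e^{\theta x}\mu(dx)$; for $\theta\in\Theta^\circ$, $\mu_\theta(dx)=e^{\theta x-\psi(\theta)}\mu(dx)$. In this setting $\psi''>0$ on $\Theta^\circ$ and $\psi':\Theta^\circ\to(A,B)$ is strictly increasing with a strictly increasing inverse $\phi:(A,B)\to\Theta^\circ$. An $m\times n$ margin is a pair $(\mathbf r,\mathbf c)\in\mathbb R^m\times\mathbb R^n$. For a real $m\times n$ matrix $\mathbf x$, $r(\mathbf x),c(\mathbf x)$ are its vectors of row and column sums; $\pi(\mathbf x)=(r(\mathbf x),c(\mathbf x))$; for $\rho\ge0$, $\mathcal T_\rho(\mathbf r,\mathbf c)=\{\mathbf x\in\mathbb R^{m\times n}:\|r(\mathbf x)-\mathbf r\|_1\le\rho,\ \|c(\mathbf x)-\mathbf c\|_1\le\rho\}$ and $\mathcal T(\mathbf r,\mathbf c)=\mathcal T_0(\mathbf r,\mathbf c)$. For $\mathbf z\in\mathbb R^{m\times n}$, $\overline{\mathbf z}$ is the $(m-1)\times(n-1)$ submatrix obtained by deleting the last row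 and column. An MLE for $(\mathbf r,\mathbf c)$ is a maximizer of $\langle\mathbf r,\boldsymbol\alpha\rangle+\langle\mathbf c,\boldsymbol\beta\rangle-\sum_{i,j}\psi(\boldsymbol\alpha(i)+\boldsymbol\beta(j))$ over $(\boldsymbol\alpha,\boldsymbol\beta)\in\mathbb R^m\times\mathbb R^n$ with all $\boldsymbol\alpha(i)+\boldsymbol\beta(j)\in\Theta^\circ$. $Y\sim\mu_{\boldsymbol\alpha\oplus\boldsymbol\beta}$ means $Y$ is an $m\times n$ random matrix with independent entries $Y_{ij}\sim\mu_{\boldsymbol\alpha(i)+\boldsymbol\beta(j)}$. $\nu=\pi_\#(\mu^{\otimes(m\times n)})$ is the pushforward of the product measure under $\pi$. When $\nu$ is $\sigma$-finite, $\{\lambda_{\mathbf r,\mathbf c}\}$ denotes the ($\nu$-a.e. unique) disintegration of $\mu^{\otimes(m\times n)}$ with respect to $\pi$: for $\nu$-a.e. $\mathbf t=(\mathbf r,\mathbf c)$, $\lambda_{\mathbf t}$ is a probability measure on $\mathbb R^{m\times n}$ with $\lambda_{\mathbf t}(\pi\ne\mathbf t)=0$, and for every nonnegative measurable $h$, $\mathbf t\mapsto\int h\,d\lambda_{\mathbf t}$ is measurable and $\int h\,d\mu^{\otimes(m\times n)}=\iint h\,d\lambda_{\mathbf t}\,\nu(d\mathbf t)$. It gives the law of a matrix from the base model $\mu^{\otimes(m\times n)}$ conditioned to have margin $(\mathbf r,\mathbf c)$. The law of $Y$ conditional on $Y\in\mathcal T(\mathbf r,\mathbf c)$ is likewise understood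 through the disintegration of the law of $Y$ with respect to $\pi$.
   Formalization: The inequality in (ii) is proved for h ≥ 0 only (false for h = -1). Conditional laws and densities depend on chosen versions: results hold for each fixed (α,β) and a.e. margin, and at the margin's own MLE when the versions vary continuously with (α,β). *)

(* Defs.v *)
From HB Require Import structures.
From mathcomp Require Import all_boot all_order all_algebra.
From mathcomp Require Import all_classical all_reals all_analysis.
From mathcomp Require Import measurable_realfun.

Set Implicit Arguments.
Unset Strict Implicit.
Unset Printing Implicit Defensive.

Import Order.TTheory GRing.Theory Num.Theory.
Import numFieldNormedType.Exports.

Local Open Scope classical_set_scope.
Local Open Scope ring_scope.
Local Open Scope ereal_scope.

(* Matrices carry the product sigma-algebra, generated by the entries; over
   the reals this is the Borel sigma-algebra of R^(m x n). *)
Definition measure_matrix_display : measure_display -> measure_display.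
Proof. exact. Qed.

Section measurable_matrix.
Context {d} {T : sigmaRingType d} (m n : nat).

Definition matrix_measurable : set (set 'M[T]_(m, n)) :=
  <<s \bigcup_(ij in [set: 'I_m * 'I_n])
        preimage_set_system setT (fun x : 'M[T]_(m, n) => x ij.1 ij.2)
                            measurable >>.

Let matrix_set0 : matrix_measurable set0.
Proof. exact: sigma_algebra0. Qed.

Let matrix_setC A : matrix_measurable A -> matrix_measurable (~` A).
Proof. exact: sigma_algebraC. Qed.

Let matrix_bigcup (F : _^nat) : (forall i, matrix_measurable (F i)) ->
  matrix_measurable (\bigcup_i (F i)).
Proof. exact: sigma_algebra_bigcup. Qed.

HB.instance Definition _ := @isMeasurable.Build (measure_matrix_display d)
  'M[T]_(m, n) matrix_measurable matrix_set0 matrix_setC matrix_bigcup.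

End measurable_matrix.

Section exponential_family.
Context {R : realType}.
Variable mu : set (measurableTypeR R) -> \bar R.

Definition laplace (theta : R) : \bar R := \int[mu]_x (expR (theta * x))%:E.

Definition Theta : set R := [set theta | laplace theta < +oo].

Definition psi (theta : R) : R := ln (fine (laplace theta)).

Definition tilt (theta : R) (A : set (measurableTypeR R)) : \bar R :=
  \int[mu]_(x in A) (expR (theta * x - psi theta))%:E.

End exponential_family.

(* Pairs (r, c), and also parameters (alpha, beta), of an m x n matrix. *)
Notation margin R m n := ('rV[R]_m * 'rV[R]_n)%type.

Section margins.
Context {R : realType} {m n : nat}.

Definition margin_of (x : 'M[R]_(m, n)) : margin R m n :=
  (\row_i (\sum_j x i j)%R, \row_j (\sum_i x i j)%R).

Definition transport (rho : R) (t : margin R m n) : set 'M[R]_(m, n) :=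
  [set x | (\sum_i `|(margin_of x).1 0 i - t.1 0 i| <= rho)%R /\
           (\sum_j `|(margin_of x).2 0 j - t.2 0 j| <= rho)%R].

Variable mu : set (measurableTypeR R) -> \bar R.

Definition admissible : set (margin R m n) :=
  [set ab : margin R m n | forall i j, (Theta mu)° (ab.1 0 i + ab.2 0 j)%R].

Definition loglik (t ab : margin R m n) : R :=
  (\sum_i t.1 0 i * ab.1 0 i + \sum_j t.2 0 j * ab.2 0 j
   - \sum_i \sum_j psi mu (ab.1 0 i + ab.2 0 j))%R.

Definition is_MLE (t ab : margin R m n) : Prop :=
  admissible ab /\
  forall ab', admissible ab' -> (loglik t ab' <= loglik t ab)%R.

(* P is the product of the sigma-finite measures f i j, which determine it
   uniquely; when P is the law of a random matrix, its entries are
   independent with laws f i j. *)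
Definition is_product_measure
    (f : 'I_m -> 'I_n -> set (measurableTypeR R) -> \bar R)
    (P : set 'M[R]_(m, n) -> \bar R) : Prop :=
  forall A : 'I_m -> 'I_n -> set (measurableTypeR R),
    (forall i j, measurable (A i j)) ->
    P [set x | forall i j, A i j (x i j)] = \prod_i \prod_j f i j (A i j).

(* The law, as a function of ab, of a matrix with independent entries
   Y i j ~ mu_(alpha i + beta j). *)
Definition is_tilted_law (ab : margin R m n)
    (P : set 'M[R]_(m, n) -> \bar R) : Prop :=
  is_product_measure (fun i j => tilt mu (ab.1 0 i + ab.2 0 j)%R) P.

End margins.

Definition disintegration d d' (T : measurableType d) (T' : measurableType d')
    (R : realType) (M : {measure set T -> \bar R}) (f : T -> T')
    (lam : T' -> {measure set T -> \bar R}) : Prop :=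
  [/\ {ae pushforward M f, forall t, lam t setT = 1},
      {ae pushforward M f, forall t, lam t [set x | f x <> t] = 0}
    & forall h : T -> \bar R, measurable_fun setT h -> (forall x, 0 <= h x) ->
        measurable_fun setT (fun t => \int[lam t]_x h x) /\
        \int[M]_x h x = \int[pushforward M f]_t \int[lam t]_x h x].

Definition is_cond_law d d1 d2 (T : measurableType d) (T1 : measurableType d1)
    (T2 : measurableType d2) (R : realType) (P : probability T R)
    (f : T -> T1) (g : T -> T2) (kappa : R.-pker T1 ~> T2) : Prop :=
  forall A B, measurable A -> measurable B ->
    P [set x | A (f x) /\ B (g x)] = \int[pushforward P f]_(y in A) kappa y B.

Section conclusions.
Context {R : realType} {m n : nat}.
Implicit Types (t ab : margin R m.+1 n.+1).

Definition block (x : 'M[R]_(m.+1, n.+1)) : 'M[R]_(m, n) :=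
  \matrix_(i < m, j < n) x (widen_ord (leqnSn m) i) (widen_ord (leqnSn n) j).

Definition same_law d (T : measurableType d) (P Q : set T -> \bar R) : Prop :=
  forall A, measurable A -> P A = Q A.

(* p y t is a jointly measurable version of the Radon-Nikodym derivative at t
   of the law of margin_of Y given block Y = y with respect to the law of
   margin_of Y, where Y ~ P. *)
Definition is_margin_density (P : probability 'M[R]_(m.+1, n.+1) R)
    (kappa : R.-pker 'M[R]_(m, n) ~> margin R m.+1 n.+1)
    (p : 'M[R]_(m, n) -> margin R m.+1 n.+1 -> R) : Prop :=
  [/\ forall y t, (0 <= p y t)%R,
      measurable_fun setT
        (fun z : 'M[R]_(m, n) * margin R m.+1 n.+1 => p z.1 z.2)
    & {ae pushforward P block, forall y B, measurable B ->
        kappa y B = \int[pushforward P margin_of]_(s in B) (p y s)%:E}].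

(* L is the law of X, P the law of Y, and p y the density at a fixed margin.
   For signed h the inequality fails (take h = -1), hence the 0 <= h. *)
Definition block_comparison (L P : set 'M[R]_(m.+1, n.+1) -> \bar R)
    (p : 'M[R]_(m, n) -> R) : Prop :=
  (forall h : 'M[R]_(m, n) -> R, measurable_fun setT h ->
     (exists b : R, forall y, (`|h y| <= b)%R) ->
     \int[L]_x (h (block x))%:E = \int[P]_y (p (block y) * h (block y))%:E /\
     ((forall y, (0 <= h y)%R) ->
      \int[P]_y (p (block y) * h (block y))%:E <=
        ereal_sup (range (fun y => (p y)%:E)) * \int[P]_y (h (block y))%:E)) /\
  (forall q : 'M[R]_(m, n) -> R,
     (exists2 c : R, (0 < c)%R & forall y, p y = (c * q y)%R) ->
     ereal_sup (range (fun y => (p y)%:E)) =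
       ereal_sup (range (fun y => (q y)%:E))
       * (\int[P]_y (q (block y))%:E)^-1).

End conclusions.

(* Main.v *)
(* For a fixed parameter, Y = Y_ab has density exp (loglik (pi x) ab) with
   respect to M, a positive function of the margin pi x alone.  Hence the
   disintegration lam of M along pi is also a disintegration of the law of Y,
   and (i) is uniqueness of disintegrations, tested on the countable pi-system
   of rational boxes.  For (ii), P(block Y in A, pi Y in E) is computed both
   through lam and through the joint density p; Tonelli's theorem shows that
   the block has law p(., t) K under lam_t, where K is the law of block Y.
   For a parameter moving with t, one null set serves all rational parameters.
   In (i) the other parameters follow by continuity; in (ii) the laws K_ab are
   first compared with a common one, by block-wise densities that depend
   continuously on ab, because psi is continuous on the interior of Theta. *)
From HB Require Import structures.
Require Import Defs.
From mathcomp Require Import all_boot all_order all_algebra.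
From mathcomp Require Import all_classical all_reals all_analysis.
From mathcomp Require Import measurable_realfun.
From mathcomp Require Import ring lra.

Set Implicit Arguments.
Unset Strict Implicit.
Unset Printing Implicit Defensive.

Import Order.TTheory GRing.Theory Num.Theory.
Import numFieldNormedType.Exports.

Local Open Scope classical_set_scope.
Local Open Scope ring_scope.
Local Open Scope ereal_scope.

(** * Densities and products *)

Section density.
Context d (T : measurableType d) (R : realType).
Variables (mu : {measure set T -> \bar R}) (g : T -> R).
Hypotheses (mg : measurable_fun setT g) (g0 : forall x, (0 <= g x)%R).

Definition density_measure (A : set T) : \bar R := \int[mu]_(x in A) (g x)%:E.

Let density0 : density_measure set0 = 0.
Proof. exact: integral_set0. Qed.

Let density_ge0 A : 0 <= density_measure A.
Proof. by apply: integral_ge0 => x _; rewrite lee_fin. Qed.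

Let density_sigma_additive : semi_sigma_additive density_measure.
Proof.
apply: semi_sigma_additive_nng_induced; first exact/measurable_EFinP.
by move=> x; rewrite lee_fin.
Qed.

HB.instance Definition _ := isMeasure.Build _ _ _ density_measure
  density0 density_ge0 density_sigma_additive.

Definition density : {measure set T -> \bar R} := density_measure.

End density.

Section density_theory.
Context d (T : measurableType d) (R : realType).
Implicit Types (mu nu : {measure set T -> \bar R}) (g : T -> R).

Import HBNNSimple.

Lemma integral_indicM mu g (A : set T) :
  \int[mu]_x (\1_A x * g x)%:E = \int[mu]_(x in A) (g x)%:E.
Proof.
rewrite [RHS]integral_mkcond; apply: eq_integral => x _.
by rewrite patchE indicE; case: (x \in A); rewrite ?mul1r ?mul0r.
Qed.

(** Monotone convergence along simple functions reduces this to indicators of level sets, where it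
    is the hypothesis on [nu]. *)
Lemma ge0_integral_density mu nu g : measurable_fun setT g ->
    (forall x, (0 <= g x)%R) ->
    (forall A, measurable A -> nu A = \int[mu]_(x in A) (g x)%:E) ->
  forall f : T -> \bar R, measurable_fun setT f -> (forall x, 0 <= f x) ->
  \int[nu]_x f x = \int[mu]_x (f x * (g x)%:E).
Proof.
move=> mg g0 nuE f mf f0; pose h := nnsfun_approx measurableT mf.
have fE x : f x = limn (EFin \o h ^~ x).
  by apply/esym/cvg_lim => //; exact: cvg_nnsfun_approx.
have gE x : f x * (g x)%:E = limn (fun n => (h n x * g x)%:E).
  apply/esym/cvg_lim => //; under eq_fun do rewrite EFinM.
  by apply: cvgeZr => //; exact: cvg_nnsfun_approx.
under eq_integral do rewrite fE.
under [RHS]eq_integral do rewrite gE.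
rewrite monotone_convergence//; last 3 first.
- by move=> n; exact/measurable_EFinP.
- by move=> n x _; rewrite lee_fin.
- by move=> x _ a b ab; rewrite lee_fin; exact/lefP/nd_nnsfun_approx.
rewrite monotone_convergence//; last 3 first.
- by move=> n; apply/measurable_EFinP; exact: measurable_funM.
- by move=> n x _; rewrite lee_fin mulr_ge0.
- move=> x _ a b ab; rewrite lee_fin ler_wpM2r//.
  exact/lefP/nd_nnsfun_approx.
congr (limn _); apply/funext => n.
transitivity (\int[nu]_x (\sum_(y \in range (h n))
   (y * \1_(h n @^-1` [set y]) x)%:E)).
  by apply: eq_integral => t _; rewrite /= fimfunE -fsumEFin.
rewrite ge0_integral_fsum//; last 2 first.
- by move=> r; apply/measurable_EFinP; exact: measurable_funM.
- by move=> r t _; exact: nnfun_muleindic_ge0.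
transitivity (\int[mu]_x (\sum_(y \in range (h n))
   ((g x)%:E * (y * \1_(h n @^-1` [set y]) x)%:E))); last first.
  apply: eq_integral => t _; rewrite -ge0_mule_fsumr; last first.
    by move=> r; exact: nnfun_muleindic_ge0.
  by rewrite fsumEFin// EFinM muleC [in RHS]fimfunE.
rewrite ge0_integral_fsum//; last 2 first.
- move=> r; apply/measurable_EFinP; apply: measurable_funM => //.
  exact: measurable_funM.
- by move=> r t _; rewrite mule_ge0 ?lee_fin//; exact: nnfun_muleindic_ge0.
(* Writing the value [y] as [h n t] makes it visibly nonnegative, as pulling it out of both
   integrals requires. *)
apply: eq_fsbigr => y /set_mem[t _ <-].
under eq_integral do rewrite EFinM.
rewrite ge0_integralZl ?lee_fin//; last first.
  by apply/measurable_EFinP.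
under [RHS]eq_integral do rewrite -EFinM mulrC -mulrA EFinM.
rewrite ge0_integralZl ?lee_fin//; last 2 first.
- by apply/measurable_EFinP; exact: measurable_funM.
- by move=> x _; rewrite lee_fin mulr_ge0.
by rewrite integral_indicM integral_indic// setIT nuE.
Qed.

Lemma ge0_integral_density_in mu nu g : measurable_fun setT g ->
    (forall x, (0 <= g x)%R) ->
    (forall A, measurable A -> nu A = \int[mu]_(x in A) (g x)%:E) ->
  forall (D : set T) (f : T -> \bar R), measurable D -> measurable_fun setT f ->
    (forall x, 0 <= f x) ->
  \int[nu]_(x in D) f x = \int[mu]_(x in D) (f x * (g x)%:E).
Proof.
move=> mg g0 nuE D f mD mf f0; rewrite !(integral_mkcond D).
rewrite (@ge0_integral_density mu nu g)//.
- apply: eq_integral => x _; rewrite !patchE; case: ifP => //.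
  by rewrite mul0e.
- by apply/(measurable_restrictT _ mD)/measurable_funTS.
- by move=> x; rewrite patchE; case: ifP.
Qed.

(** The factor may be infinite because it will be a product of integrals over other coordinates,
    none of which is assumed finite. *)
Lemma ge0_integral_scale mu nu (c : \bar R) : 0 <= c ->
    (forall A, measurable A -> nu A = c * mu A) ->
  forall f : T -> \bar R, measurable_fun setT f -> (forall x, 0 <= f x) ->
  \int[nu]_x f x = c * \int[mu]_x f x.
Proof.
case: c => [c||//] c0 nuE f mf f0.
  rewrite lee_fin in c0; pose k := NngNum c0.
  rewrite -(@ge0_integral_mscale _ _ _ _ _ _ k)//.
  by apply: eq_measure_integral => A mA _; rewrite nuE.
(* [+oo * mu] is the sum of countably many copies of [mu]. *)
have yE (x : \bar R) : 0 <= x -> +oo * x = \sum_(n <oo) x.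
  move=> x0; rewrite -ge0_integral_count// integral_cst// muleC.
  by congr (_ * _); rewrite /= /counting; case: asboolP => // /infinite_nat.
rewrite yE ?integral_ge0//.
rewrite -(ge0_integral_measure_series (fun _ => mu))//.
apply: eq_measure_integral => A mA _.
by rewrite nuE// yE.
Qed.

End density_theory.

Lemma measurable_forall_coord d d' (W : measurableType d)
    (T : measurableType d') (I : finType) (X : I -> W -> T) (A : I -> set T) :
  (forall i, measurable_fun setT (X i)) -> (forall i, measurable (A i)) ->
  measurable [set w | forall i, A i (X i w)].
Proof.
move=> mX mA.
rewrite (_ : [set w | _] = \bigcap_(i in [set: I]) (X i @^-1` A i)).
  apply: fin_bigcap_measurable => // i _.
  by rewrite -[X in measurable X]setTI; exact: mX.
by apply/seteqP; split => [w Aw i _|w Aw i]; exact: Aw.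
Qed.

(* The functions are replaced one at a time: if all but the one at [k] are
   fixed, the integral of [u k (X k w)] against the remaining product is the
   integral of [u k] against a multiple of [f k]. *)
Lemma ge0_integral_prod_coord d d' (W : measurableType d)
    (T : measurableType d') (R : realType) (I : finType)
    (P : {measure set W -> \bar R})
    (X : I -> W -> T) (f : I -> {measure set T -> \bar R}) :
  (forall i, measurable_fun setT (X i)) ->
  (forall A : I -> set T, (forall i, measurable (A i)) ->
     P [set w | forall i, A i (X i w)] = \prod_i f i (A i)) ->
  forall u : I -> T -> R,
    (forall i, measurable_fun setT (u i)) -> (forall i x, (0 <= u i x)%R) ->
  \int[P]_w (\prod_i u i (X i w))%:E = \prod_i \int[f i]_x (u i x)%:E.
Proof.
move=> mX PE.
(* Induction on a list [s] of coordinates outside which the functions are already indicators. *)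
suff H (s : seq I) (u : I -> T -> R) :
    (forall i, measurable_fun setT (u i)) -> (forall i x, (0 <= u i x)%R) ->
    (forall i, i \notin s -> exists2 A, measurable A & u i = \1_A) ->
    \int[P]_w (\prod_i u i (X i w))%:E = \prod_i \int[f i]_x (u i x)%:E.
  by move=> u mu u0; apply: (H (enum I)) => // i; rewrite mem_enum.
elim: s u => [|k s IH] u mu u0 uA.
  have /choice[A AP] i : exists A : set T, measurable A /\ u i = \1_A.
    by have [//|A mA uE] := uA i; exists A.
  have mA i : measurable (A i) by case: (AP i).
  rewrite (eq_integral (fun w => (\1_[set w | forall i, A i (X i w)] w)%:E)).
    rewrite integral_indic//; last exact: measurable_forall_coord.
    rewrite setIT PE//; apply: eq_bigr => i _; case: (AP i) => _ ->.
    by rewrite integral_indic// setIT.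
  move=> w _; congr EFin; rewrite indicE.
  case: (boolP (_ \in _)) => [/set_mem Aw|/negP nAw].
    by rewrite big1// => i _; case: (AP i) => _ ->; rewrite indicE mem_set.
  have /existsNP[i Ai] : ~ forall i, A i (X i w).
    by move=> Aw; apply: nAw; rewrite inE.
  by rewrite (bigD1 i)//=; case: (AP i) => _ ->; rewrite indicE memNset ?mul0r.
pose v w := (\prod_(i | i != k) u i (X i w))%R.
have mv : measurable_fun setT v.
  rewrite /v; under eq_fun do rewrite -big_filter.
  by apply: measurable_prod => i _; exact: measurableT_comp.
have v0 w : (0 <= v w)%R by apply: prodr_ge0 => i _.
pose C := \prod_(i | i != k) \int[f i]_x (u i x)%:E.
have C0 : 0 <= C.
  apply: prode_ge0 => i _; apply: integral_ge0 => x _.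
  by rewrite lee_fin.
rewrite (bigD1 k)//= -/C muleC.
rewrite -(@ge0_integral_scale _ _ _ (f k)
  (pushforward (density P mv v0) (X k)) C C0)//; first last.
- by move=> x; rewrite lee_fin.
- exact/measurable_EFinP.
(* Under the density [v], the image of [P] by [X k] is [C] times [f k]: on a set [A] this is the
   induction hypothesis with [\1_A] in slot [k]. *)
- move=> A mA; pose u' i := if i == k then \1_A else u i.
  rewrite /= /pushforward /density_measure -integral_indicM.
  transitivity (\prod_i \int[f i]_x (u' i x)%:E).
    rewrite -IH; first last.
    - move=> i; rewrite /u'; case: ifPn => [_ _|ik iNs].
        by exists A.
      by apply: uA; rewrite inE negb_or ik.
    - by move=> i x; rewrite /u'; case: ifP.
    - by move=> i; rewrite /u'; case: ifP.
    apply: eq_integral => w _; rewrite (bigD1 k)//= {1}/u' eqxx.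
    congr ((_ * _)%:E); apply: eq_bigr => i ik.
    by rewrite /u' (negbTE ik).
  rewrite (bigD1 k)//= {1}/u' eqxx integral_indic// setIT muleC.
  by congr (_ * _); apply: eq_bigr => i ik; rewrite /u' (negbTE ik).
rewrite (ge0_integral_pushforward (mX k))//; first last.
- by move=> x _; rewrite lee_fin.
- exact/measurable_EFinP.
rewrite preimage_setT
  (@ge0_integral_density _ _ _ P (density P mv v0) v mv v0)//.
- by apply: eq_integral => w _; rewrite /= (bigD1 k)// EFinM.
- by apply/measurable_EFinP; exact: measurableT_comp.
- by move=> x; rewrite lee_fin.
Qed.

(** * The matrix sigma-algebra *)

Lemma ae_forall_countable d (T : measurableType d) (R : realType)
    (mu : {measure set T -> \bar R}) (I : countType) (P : I -> T -> Prop) :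
  (forall i, {ae mu, forall x, P i x}) -> {ae mu, forall x, forall i, P i x}.
Proof.
move=> aeP; pose Q n x := if unpickle n is Some i then P i x else True.
have /ae_foralln : forall n, {ae mu, forall x, Q n x}.
  by move=> n; rewrite /Q; case: unpickle => [i|]; [exact: aeP|exact: aeW].
by apply: filterS => x Qx i; have := Qx (pickle i); rewrite /Q pickleK.
Qed.

Section measurable_matrix_theory.
Context d (T : measurableType d) (m n : nat).

Lemma measurable_entry (i : 'I_m) (j : 'I_n) :
  measurable_fun setT (fun x : 'M[T]_(m, n) => x i j).
Proof.
move=> _ A mA; rewrite setTI; apply: sub_sigma_algebra.
by exists (i, j) => //; exists A => //; rewrite setTI.
Qed.

Lemma measurable_fun_matrix d' (W : measurableType d') (f : W -> 'M[T]_(m, n)) :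
  (forall i j, measurable_fun setT (fun w => f w i j)) -> measurable_fun setT f.
Proof.
move=> mf; apply: (@measurability _ _ _ _ setT f (\bigcup_(ij in setT)
  preimage_set_system setT (fun x : 'M[T]_(m, n) => x ij.1 ij.2)
    (@measurable d T)) erefl) => _ [_ [[i j] _ [A mA <-]] <-].
rewrite !setTI -[X in measurable X]setTI.
exact: (mf i j measurableT A mA).
Qed.

End measurable_matrix_theory.

Section rational_boxes.
Context {R : realType} {m n : nat}.

(* [None] gives the whole line, so that the rational boxes include the whole
   space, as needed to compare finite measures. *)
Definition ray (q : option rat) : set R :=
  if q is Some r then [set x | (x < ratr r)%R] else setT.

Definition box (q : 'M[option rat]_(m, n)) : set 'M[R]_(m, n) :=
  [set x | forall i j, ray (q i j) (x i j)].

Lemma measurable_ray q : measurable (ray q).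
Proof.
case: q => [q|]; last exact: measurableT.
by rewrite -[ray _]set_itvNyo; exact: measurable_itv.
Qed.

Lemma measurable_box q : measurable (box q).
Proof.
rewrite (_ : box q =
    [set x | forall ij : 'I_m * 'I_n, ray (q ij.1 ij.2) (x ij.1 ij.2)]).
  apply: (@measurable_forall_coord _ _ _ _ _
    (fun ij (x : 'M[R]_(m, n)) => x ij.1 ij.2) (fun ij => ray (q ij.1 ij.2))).
    by move=> ij; exact: measurable_entry.
  by move=> ij; exact: measurable_ray.
by apply/seteqP; split => [x qx [i j]|x qx i j]; [exact: qx|exact: (qx (i, j))].
Qed.

Lemma setI_ray p q : exists r, ray p `&` ray q = ray r.
Proof.
case: p q => [p|] [q|]; last 3 first.
- by exists (Some p); rewrite setIT.
- by exists (Some q); rewrite setTI.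
- by exists None; rewrite setTI.
exists (Some (Num.min p q)); apply/seteqP; split => x /=.
  by rewrite /Num.min; case: ifP => _ [].
move=> x_lt; split; apply: (lt_le_trans x_lt); rewrite ler_rat ge_min lexx//.
by rewrite orbT.
Qed.

Lemma setI_closed_box : setI_closed (range box).
Proof.
move=> _ _ [p _ <-] [q _ <-].
have /choice[r rE] ij := setI_ray (p ij.1 ij.2) (q ij.1 ij.2).
exists (\matrix_(i, j) r (i, j)) => //; apply/seteqP; split=> x /=.
  by move=> rx; split=> i j; have := rx i j; rewrite mxE -(rE (i, j)) => -[].
by move=> [px qx] i j; rewrite mxE -(rE (i, j)); split; [exact: px|exact: qx].
Qed.

(** Half-lines generate the Borel sets, and the set where one entry is below [x] is the union, over
    rationals [q < x], of the boxes that only constrain that entry to be below [q]. *)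
Lemma measurable_box_gen : @measurable _ 'M[R]_(m, n) = <<s range box >>.
Proof.
apply/seteqP; split; last first.
  apply: smallest_sub; first exact: sigma_algebra_measurable.
  by move=> _ [q _ <-]; exact: measurable_box.
apply: smallest_sub; first exact: smallest_sigma_algebra.
move=> _ [[i j] _ [A mA <-]] /=.
pose entry (x : g_sigma_algebraType (range box)) := (x : 'M[R]_(m, n)) i j.
suff : measurable_fun setT entry by apply.
apply: (measurability _ (RGenInftyO.measurableE R)) => _ [_ [x ->] <-].
rewrite setTI (_ : _ @^-1` _ = \bigcup_(q : rat)
    if (ratr q < x)%R
    then box (\matrix_(k, l) if (k == i) && (l == j) then Some q else None)
    else set0).
  apply: bigcupT_measurable_rat => q; case: ifP => // _.
  by apply: sub_sigma_algebra; eexists.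
apply/seteqP; split => y /=.
  rewrite /entry in_itv/= => yx.
  have [q] := rat_in_itvoo yx; rewrite in_itv/= => /andP[yq qx].
  exists q => //; rewrite qx => k l.
  by rewrite mxE; case: ifP => [/andP[/eqP-> /eqP->]|].
move=> [q _]; case: ifPn => // qx /(_ i j); rewrite mxE !eqxx/= => yq.
by rewrite /entry in_itv/=; exact: lt_trans qx.
Qed.

(** The boxes form a generating pi-system that contains the whole space, so one finite total mass is
    enough for uniqueness. *)
Lemma eq_measure_box (m1 m2 : {measure set 'M[R]_(m, n) -> \bar R}) :
    m1 setT < +oo -> (forall q, m1 (box q) = m2 (box q)) ->
  forall A, measurable A -> m1 A = m2 A.
Proof.
move=> m1oo m12 A mA.
have boxT : box (const_mx None) = setT.
  by apply/seteqP; split => // x _ i j; rewrite mxE.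
apply: (measure_unique (range box) (fun=> setT)) => //.
- exact: measurable_box_gen.
- exact: setI_closed_box.
- by move=> _; exists (const_mx None).
- by rewrite bigcup_const.
- by move=> _ [q _ <-].
Qed.

End rational_boxes.

(** * Disintegrations *)

Section image_measure.
Context d d' (T : measurableType d) (T' : measurableType d') (R : realType).
Variables (M : {measure set T -> \bar R}) (f : T -> T').
Hypothesis mf : measurable_fun setT f.

(** Keeping measurability of [f] as an argument lets the bare [pushforward] of the statements carry
    its measure structure. *)
Definition image_measure : {measure set T' -> \bar R}.
Proof. by refine (pushforward M f : {measure set T' -> \bar R}). Defined.

Lemma ae_image (P Q : T' -> Prop) : (forall t, P t -> Q t) ->
  {ae pushforward M f, forall t, P t} -> {ae pushforward M f, forall t, Q t}.
Proof.
exact: (@filterS _ _ (ae_filter_ringOfSetsType image_measure) P Q).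
Qed.

Lemma ae_image2 (P Q S : T' -> Prop) : (forall t, P t -> Q t -> S t) ->
  {ae pushforward M f, forall t, P t} -> {ae pushforward M f, forall t, Q t} ->
  {ae pushforward M f, forall t, S t}.
Proof.
exact: (@filterS2 _ _ (ae_filter_ringOfSetsType image_measure) P Q S).
Qed.

End image_measure.

Lemma ge0_integral_ae_eq d (T : measurableType d) (R : realType)
    (mu : {measure set T -> \bar R}) (f g : T -> \bar R) :
    measurable_fun setT f -> measurable_fun setT g -> (forall x, 0 <= f x) ->
    \int[mu]_x f x < +oo ->
    (forall E, measurable E -> \int[mu]_(x in E) f x = \int[mu]_(x in E) g x) ->
  {ae mu, forall x, f x = g x}.
Proof.
move=> mf mg f0 foo fg.
have /integral_ae_eq : mu.-integrable setT f.
  apply/integrableP; split => //; under eq_integral => x _ do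
    rewrite gee0_abs//.
  by [].
move=> /(_ measurableT g mg (fun E _ mE => fg E mE)).
by apply: filterS => x; apply.
Qed.

Section positive_density.
Context d (T : measurableType d) (R : realType).
Variables (mu nu : {measure set T -> \bar R}) (g : T -> R).
Hypotheses (mg : measurable_fun setT g) (g_gt0 : forall x, (0 < g x)%R).
Hypothesis nuE : forall A, measurable A -> nu A = \int[mu]_(x in A) (g x)%:E.

(** For the converse direction, a vanishing integral of [g] over [A] forces [g] to vanish almost
    everywhere on [A]; since [g] is positive, [A] must be null. *)
Lemma density_null A : measurable A -> mu A = 0 <-> nu A = 0.
Proof.
move=> mA; split=> A0.
  by rewrite nuE// null_set_integral//; exact/measurable_funTS/measurable_EFinP.
have mgA : measurable_fun A (EFin \o g).
  exact/measurable_funTS/measurable_EFinP.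
have [+ _] := ae_eq_integral_abs mu mA mgA.
under eq_integral => x _ do rewrite gee0_abs ?lee_fin ?ltW//.
rewrite -nuE// => /(_ A0) [N [mN N0 AN]].
apply: (subset_measure0 mA mN _ N0) => x Ax; apply: AN => /= /(_ Ax) [gx0].
by have := g_gt0 x; rewrite gx0 ltxx.
Qed.

Lemma density_ae (Q : T -> Prop) :
  {ae mu, forall x, Q x} <-> {ae nu, forall x, Q x}.
Proof.
by split=> -[A [mA A0 QA]]; exists A; split => //; apply/density_null.
Qed.

End positive_density.

Section disintegration_theory.
Context d d' (T : measurableType d) (T' : measurableType d') (R : realType).
Variables (f : T -> T') (mf : measurable_fun setT f).
Hypothesis m1 : forall t : T', measurable [set t].

Lemma measurable_off_fiber t : measurable [set x | f x <> t].
Proof.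
rewrite (_ : [set x | _] = setT `&` f @^-1` (~` [set t])); last first.
  by rewrite setTI.
by apply: mf => //; exact: measurableC.
Qed.

(** [L] lives on the fiber of [f] over [t], where [g \o f] is the constant [g t]. *)
Lemma ge0_integral_fiber (L : {measure set T -> \bar R}) (t : T')
    (h : T -> \bar R) (g : T' -> R) :
  L [set x | f x <> t] = 0 -> measurable_fun setT h -> (forall x, 0 <= h x) ->
  measurable_fun setT g -> (forall s, (0 <= g s)%R) ->
  \int[L]_x (h x * (g (f x))%:E) = (\int[L]_x h x) * (g t)%:E.
Proof.
move=> Lt mh h0 mg g0; rewrite -ge0_integralZr ?lee_fin//.
apply: ge0_ae_eq_integral => //.
- by apply: emeasurable_funM => //; apply/measurable_EFinP/measurableT_comp.
- exact: emeasurable_funM.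
- by move=> x _; rewrite mule_ge0 ?lee_fin.
- by move=> x _; rewrite mule_ge0 ?lee_fin.
exists [set x | f x <> t]; split => //; first exact: measurable_off_fiber.
by move=> x /= hx fxt; apply: hx => _; rewrite fxt.
Qed.

Lemma disintegration_measurable (M : {measure set T -> \bar R})
    (lam : T' -> {measure set T -> \bar R}) A :
  disintegration M f lam -> measurable A -> measurable_fun setT (lam ^~ A).
Proof.
move=> [_ _ lamE] mA; have [||+ _] := lamE (EFin \o \1_A).
- exact/measurable_EFinP.
- by move=> x /=; rewrite lee_fin.
under eq_fun do rewrite integral_indic// setIT.
by [].
Qed.

(** Since [lam t] lives on the fiber over [t], the condition that [f] lies in [E] becomes the
    condition that [t] does. *)
Lemma disintegrationE (M : {measure set T -> \bar R})
    (lam : T' -> {measure set T -> \bar R}) A E :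
  disintegration M f lam -> measurable A -> measurable E ->
  M (A `&` f @^-1` E) = \int[pushforward M f]_(t in E) lam t A.
Proof.
move=> Mlam mA mE; have [_ lamt /(_ (EFin \o \1_(A `&` f @^-1` E)))] := Mlam.
have mfE : measurable (f @^-1` E).
  by rewrite -[X in measurable X]setTI; exact: mf.
have mAE : measurable (A `&` f @^-1` E) by exact: measurableI.
case.
- by apply/measurable_EFinP.
- by move=> x /=; rewrite lee_fin.
move=> _; rewrite integral_indic// setIT => ->.
under eq_integral do rewrite integral_indic// setIT.
rewrite -/(image_measure M mf) [RHS]integral_mkcond.
apply: ge0_ae_eq_integral => //.
- exact: (disintegration_measurable Mlam).
- apply/(measurable_restrictT _ mE)/measurable_funTS.
  exact: (disintegration_measurable Mlam).
- by move=> t _; rewrite patchE; case: ifP.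
apply: (ae_image mf) lamt => t /= lamt _.
rewrite patchE; case: ifPn => [/set_mem Et|/negP nEt].
  (* For [t] in [E], the set [A] is covered by its intersection with the preimage of [E] and the
     [lam t]-null part off the fiber. *)
  apply/eqP; rewrite eq_le le_measure ?inE//= -[leRHS]adde0 -lamt.
  rewrite (le_trans _ (measureU2 _ _ _))//; last exact: measurable_off_fiber.
  apply: le_measure; rewrite ?inE//.
    by apply: measurableU => //; exact: measurable_off_fiber.
  by move=> x Ax; have [fxt|] := pselect (f x = t);
    [left; split => //=; rewrite fxt|right].
apply: (subset_measure0 mAE (measurable_off_fiber t)) lamt => x [_ Efx] fxt.
by apply: nEt; rewrite inE -fxt.
Qed.

Lemma image_measure_density (M P : {measure set T -> \bar R}) (g : T' -> R) :
    measurable_fun setT g -> (forall t, (0 <= g t)%R) ->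
    (forall A, measurable A -> P A = \int[M]_(x in A) (g (f x))%:E) ->
  forall E, measurable E ->
  image_measure P mf E = \int[image_measure M mf]_(t in E) (g t)%:E.
Proof.
move=> mg g0 PE E mE; rewrite ge0_integral_pushforward//.
- by rewrite -PE// -[X in measurable X]setTI; exact: mf.
- exact/measurable_funTS/measurable_EFinP.
- by move=> t _; rewrite lee_fin.
Qed.

(** A density that factors through [f] is constant under each [lam t]: it reweights the image
    measure by [g] and leaves the fiber measures unchanged. *)
Lemma disintegration_density (M P : {measure set T -> \bar R}) (g : T' -> R)
    (lam : T' -> {measure set T -> \bar R}) :
    measurable_fun setT g -> (forall t, (0 < g t)%R) ->
    (forall A, measurable A -> P A = \int[M]_(x in A) (g (f x))%:E) ->
  disintegration M f lam -> disintegration P f lam.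
Proof.
move=> mg g_gt0 PE [lam1 lamt lamE].
have g0 t : (0 <= g t)%R by exact: ltW.
have mgf : measurable_fun setT (g \o f) by exact: measurableT_comp.
have NE := image_measure_density mg g0 PE.
split.
- exact/(density_ae (mu := image_measure M mf) (nu := image_measure P mf) mg).
- exact/(density_ae (mu := image_measure M mf) (nu := image_measure P mf) mg).
move=> h mh h0; have [mlam _] := lamE h mh h0; split => //.
rewrite (@ge0_integral_density _ _ _ M P (g \o f))//; last first.
  by move=> x; exact: g0.
have [|x|mhg ->] := lamE (fun x => h x * (g (f x))%:E).
- by apply: emeasurable_funM => //; exact/measurable_EFinP.
- by rewrite mule_ge0 ?lee_fin.
rewrite -/(image_measure M mf) -/(image_measure P mf).
rewrite (@ge0_integral_density _ _ _ (image_measure M mf)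
  (image_measure P mf) g)//; last first.
  by move=> t; exact: integral_ge0.
apply: ge0_ae_eq_integral => //.
- by apply: emeasurable_funM => //; exact/measurable_EFinP.
- by move=> t _; apply: integral_ge0 => x _; rewrite mule_ge0 ?lee_fin.
- by move=> t _; rewrite mule_ge0 ?lee_fin// integral_ge0.
apply: (ae_image mf) lamt => t /= lamt _.
exact: ge0_integral_fiber.
Qed.

End disintegration_theory.

(** On a fixed box both families, integrated over any [E], give the probability of the box
    intersected with the preimage of [E], so they agree almost everywhere; countably many boxes
    share one null set. *)
Lemma disintegration_matrix_unique d' (T' : measurableType d') (R : realType)
    (m n : nat) (f : 'M[R]_(m, n) -> T') (P : probability 'M[R]_(m, n) R)
    (lam eta : T' -> {measure set 'M[R]_(m, n) -> \bar R}) :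
  measurable_fun setT f -> (forall t : T', measurable [set t]) ->
  disintegration P f lam -> disintegration P f eta ->
  {ae pushforward P f, forall t, forall A, measurable A -> lam t A = eta t A}.
Proof.
move=> mf m1 Plam Peta; rewrite -/(image_measure P mf).
have [lam1 _ _] := Plam.
have H : {ae image_measure P mf,
    forall t, forall q, lam t (box q) = eta t (box q)}.
  apply: ae_forall_countable => q; apply: ge0_integral_ae_eq => //.
  - exact: (disintegration_measurable Plam (measurable_box q)).
  - exact: (disintegration_measurable Peta (measurable_box q)).
  - rewrite -(disintegrationE mf m1 Plam)//; last exact: measurable_box.
    rewrite preimage_setT setIT (le_lt_trans (probability_le1 _ _))//.
      exact: measurable_box.
    exact: ltry.
  - move=> E mE; have mq := @measurable_box R m n q.
    transitivity (P (box q `&` f @^-1` E)).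
      exact/esym/(disintegrationE mf m1 Plam mq mE).
    exact: (disintegrationE mf m1 Peta mq mE).
apply: filterS2 H lam1 => t lameta lamt1 A mA.
by apply: eq_measure_box => //; rewrite lamt1 ltry.
Qed.

(** * Joint densities and the block comparison *)

(** Indicators absorb the restrictions to [A] and [E] into the integrand, which reduces this to
    Tonelli on the whole product. *)
Lemma fubini_tonelli_in d1 d2 (T1 : measurableType d1) (T2 : measurableType d2)
    (R : realType) (K : {sigma_finite_measure set T1 -> \bar R})
    (N : {sigma_finite_measure set T2 -> \bar R}) (p : T1 -> T2 -> R)
    (A : set T1) (E : set T2) :
  measurable_fun setT (fun z : T1 * T2 => p z.1 z.2) ->
  (forall y t, (0 <= p y t)%R) -> measurable A -> measurable E ->
  [/\ measurable_fun setT (fun y => \int[N]_(t in E) (p y t)%:E),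
      measurable_fun setT (fun t => \int[K]_(y in A) (p y t)%:E)
    & \int[K]_(y in A) \int[N]_(t in E) (p y t)%:E =
      \int[N]_(t in E) \int[K]_(y in A) (p y t)%:E].
Proof.
move=> mp p0 mA mE.
have mG (B : set T1) (C : set T2) : measurable B -> measurable C ->
    measurable_fun setT
      (fun z : T1 * T2 => (\1_B z.1 * (\1_C z.2 * p z.1 z.2))%:E).
  move=> mB mC; apply/measurable_EFinP.
  apply: measurable_funM; first exact: (measurableT_comp _ measurable_fst).
  by apply: measurable_funM => //; exact: (measurableT_comp _ measurable_snd).
have G0 (B : set T1) (C : set T2) (z : T1 * T2) :
    0 <= (\1_B z.1 * (\1_C z.2 * p z.1 z.2))%:E.
  by rewrite lee_fin !mulr_ge0.
split.
- have := measurable_fun_fubini_tonelli_F (m2 := N) _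
    (mG setT E measurableT mE) (G0 setT E).
  congr (measurable_fun _ _); apply/funext => y.
  rewrite /fubini_F -[RHS]integral_indicM; apply: eq_integral => t _.
  by rewrite indicT/= mul1r.
- have := measurable_fun_fubini_tonelli_G (m1 := K) _
    (mG A setT mA measurableT) (G0 A setT).
  congr (measurable_fun _ _); apply/funext => t.
  rewrite /fubini_G -[RHS]integral_indicM; apply: eq_integral => y _.
  by rewrite indicT/= mul1r.
- have := fubini_tonelli (m1 := K) (m2 := N) _ (mG A E mA mE) (G0 A E).
  congr (_ = _) => /=.
    rewrite [RHS]integral_mkcond; apply: eq_integral => y _.
    rewrite patchE; case: ifPn => yA.
      rewrite -[RHS]integral_indicM.
      by apply: eq_integral => t _; rewrite indicE yA mul1r.
    apply: integral0_eq => t _.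
    by rewrite indicE (negbTE yA) mul0r.
  rewrite [RHS]integral_mkcond; apply: eq_integral => t _.
  rewrite patchE; case: ifPn => tE.
    rewrite -[RHS]integral_indicM.
    by apply: eq_integral => y _; rewrite [X in (_ * (X * _))%R]indicE tE mul1r.
  apply: integral0_eq => y _.
  by rewrite [X in (_ * (X * _))%R]indicE (negbTE tE) mul0r mulr0.
Qed.

(* With [K], [N] the laws of [b Y] and [f Y], a joint density [p] of
   [(b Y, f Y)] with respect to [K \x N] gives the density of the law of [b]
   under almost every fiber measure. *)
Lemma disintegration_joint_density d d' (T : measurableType d)
    (T' : measurableType d') (R : realType) (m n : nat) (P : probability T R)
    (b : T -> 'M[R]_(m, n)) (f : T -> T')
    (lam : T' -> {measure set T -> \bar R}) (p : 'M[R]_(m, n) -> T' -> R) :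
  measurable_fun setT b -> measurable_fun setT f ->
  (forall t : T', measurable [set t]) ->
  disintegration P f lam ->
  measurable_fun setT (fun z : 'M[R]_(m, n) * T' => p z.1 z.2) ->
  (forall y t, (0 <= p y t)%R) ->
  (forall A E, measurable A -> measurable E ->
    P (b @^-1` A `&` f @^-1` E) =
    \int[pushforward P b]_(y in A) \int[pushforward P f]_(t in E) (p y t)%:E) ->
  {ae pushforward P f, forall t, forall A, measurable A ->
    lam t (b @^-1` A) = \int[pushforward P b]_(y in A) (p y t)%:E}.
Proof.
move=> mb mf m1 Plam mp p0 PE.
have mbA A : measurable A -> measurable (b @^-1` A).
  by move=> mA; rewrite -[X in measurable X]setTI; exact: mb.
(* Bundled as random variables, [b] and [f] have laws that are probabilities, hence sigma-finite as
   Tonelli's theorem requires. *)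
pose bX : {mfun T >-> 'M[R]_(m, n)} :=
  HB.pack b (isMeasurableFun.Build _ _ _ _ b mb).
pose fX : {mfun T >-> T'} := HB.pack f (isMeasurableFun.Build _ _ _ _ f mf).
pose K : probability 'M[R]_(m, n) R := distribution P bX.
pose N : probability T' R := distribution P fX.
have [lam1 _ _] := Plam.
(* On a fixed box both sides, integrated over [E], give the probability that [b] is in the box and
   [f] in [E]. *)
have H : {ae N, forall t, forall q,
    lam t (b @^-1` (box q)) = \int[K]_(y in box q) (p y t)%:E}.
  apply: ae_forall_countable => q; have mq := @measurable_box R m n q.
  have [_ mpK _] := @fubini_tonelli_in _ _ _ _ _ K N p _ _ mp p0 mq measurableT.
  apply: ge0_integral_ae_eq => //.
  - exact: (disintegration_measurable Plam (mbA _ mq)).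
  - rewrite -(disintegrationE mf m1 Plam (mbA _ mq) measurableT).
    rewrite preimage_setT setIT (le_lt_trans (probability_le1 _ _)) ?ltry//.
    exact: mbA.
  - move=> E mE.
    transitivity (P (b @^-1` box q `&` f @^-1` E)).
      exact/esym/(disintegrationE mf m1 Plam (mbA _ mq) mE).
    rewrite PE//.
    by have [_ _ ->] := @fubini_tonelli_in _ _ _ _ _ K N p _ _ mp p0 mq mE.
apply: (@filterS2 _ _ (ae_filter_ringOfSetsType N) _ _ _ _ H lam1).
move=> t tq lamt1 A mA.
have mpt : measurable_fun setT (p ^~ t) by exact: (measurable_fun_pair1 t mp).
apply: (@eq_measure_box R m n (image_measure (lam t) mb)
  (density K mpt (fun y => p0 y t))) => //.
by rewrite /image_measure/= /pushforward preimage_setT lamt1 ltry.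
Qed.

Section comparison.
Context {R : realType} {m n : nat}.
Variables (L : {measure set 'M[R]_(m.+1, n.+1) -> \bar R})
  (P : probability 'M[R]_(m.+1, n.+1) R) (p : 'M[R]_(m, n) -> R).
Hypotheses (mb : measurable_fun setT (@block R m n))
  (mp : measurable_fun setT p) (p0 : forall y, (0 <= p y)%R) (L1 : L setT = 1)
  (LE : forall A, measurable A ->
    L (@block R m n @^-1` A) = \int[pushforward P block]_(y in A) (p y)%:E).

Let ge0_transfer (h : 'M[R]_(m, n) -> \bar R) : measurable_fun setT h ->
    (forall y, 0 <= h y) ->
  \int[L]_x h (block x) = \int[P]_x ((p (block x))%:E * h (block x)).
Proof.
move=> mh h0.
transitivity (\int[image_measure L mb]_y h y).
  by rewrite (ge0_integral_pushforward mb).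
rewrite (@ge0_integral_density _ _ _ (image_measure P mb)
  (image_measure L mb) p)// (ge0_integral_pushforward mb)//.
- by apply: eq_integral => x _; rewrite /= muleC.
- by apply: emeasurable_funM => //; exact/measurable_EFinP.
- by move=> y _; rewrite mule_ge0 ?lee_fin.
Qed.

Lemma block_comparison_density : block_comparison L P p.
Proof.
have mpb : measurable_fun setT (p \o @block R m n) by exact: measurableT_comp.
(* [p] integrates to the total mass of [L]; this fixes the normalizing constant below. *)
have P1 : \int[P]_x (p (block x))%:E = 1.
  transitivity (\int[L]_x cst 1 (@block R m n x)).
    rewrite (ge0_transfer (h := cst 1))//.
    by apply: eq_integral => x _; rewrite mule1.
  by rewrite integral_cst// L1 mule1.
split=> [h mh hb|q [c c0 pq]].
  split=> [|h0].
    (* [h] is split into positive and negative parts; [p] being nonnegative, multiplication by it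
       commutes with both. *)
    rewrite integralE [RHS]integralE; congr (_ - _).
      transitivity (\int[L]_x ((EFin \o h)^\+ (block x))).
        by apply: eq_integral => x _; rewrite !funeposE.
      rewrite ge0_transfer//; last first.
        by apply: measurable_funepos; exact/measurable_EFinP.
      apply: eq_integral => x _; rewrite !funeposE /= maxe_pMr ?lee_fin//.
      by rewrite mule0 EFinM.
    transitivity (\int[L]_x ((EFin \o h)^\- (block x))).
      by apply: eq_integral => x _; rewrite !funenegE.
    rewrite ge0_transfer//; last first.
      by apply: measurable_funeneg; exact/measurable_EFinP.
    apply: eq_integral => x _; rewrite !funenegE /= maxe_pMr ?lee_fin//.
    by rewrite mule0 -EFinM mulrN.
  have mhb : measurable_fun setT (h \o @block R m n) by exact: measurableT_comp.
  set s := ereal_sup _.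
  have s_ub y : (p y)%:E <= s by apply: ereal_sup_ubound; exists y.
  rewrite -ge0_integralZl//; last 3 first.
  - exact/measurable_EFinP.
  - by move=> x _; rewrite lee_fin.
  (* The value of [p] at the zero matrix bounds the possibly infinite [s] below by a nonnegative
     number. *)
  - by apply: le_trans (s_ub 0%R); rewrite lee_fin.
  apply: ge0_le_integral => //.
  - by move=> x _; rewrite lee_fin mulr_ge0.
  - by apply/measurable_EFinP; exact: measurable_funM.
  - by apply: emeasurable_funM => //; exact/measurable_EFinP.
  - by move=> x _; rewrite EFinM lee_wpmul2r ?lee_fin.
(* Normalization makes the mean of [q] equal to [c^-1], finite and nonzero, so its inverse is
   [c]. *)
have -> : \int[P]_y (q (block y))%:E = (c^-1)%:E.
  transitivity (\int[P]_y ((c^-1)%:E * (p (block y))%:E)).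
    by apply: eq_integral => y _; rewrite -EFinM pq mulKf ?gt_eqF.
  rewrite ge0_integralZl ?P1 ?mule1// ?lee_fin ?invr_ge0 ?(ltW c0)//.
    exact/measurable_EFinP.
  by move=> x _; rewrite lee_fin.
rewrite inver invr_eq0 gt_eqF// invrK muleC -ereal_sup_pZl//; congr ereal_sup.
apply/seteqP; split=> [_ [y _ <-]|_ [_ [y _ <-] <-]].
  by exists (q y)%:E; [exists y|rewrite -EFinM pq].
by exists y => //; rewrite pq EFinM.
Qed.

End comparison.

(** * Tilted product laws *)

Section margin_measurability.
Context {R : realType}.

Lemma measurable_set1_matrix {m n} (a : 'M[R]_(m, n)) : measurable [set a].
Proof.
rewrite (_ : [set a] =
    [set x | forall ij : 'I_m * 'I_n, [set a ij.1 ij.2] (x ij.1 ij.2)]).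
  apply: (@measurable_forall_coord _ _ _ _ _
    (fun ij (x : 'M[R]_(m, n)) => x ij.1 ij.2) (fun ij => [set a ij.1 ij.2])).
    by move=> ij; exact: measurable_entry.
  by move=> ij; exact: measurable_set1.
apply/seteqP; split=> [x -> //|x xa].
by apply/matrixP => i j; exact: (xa (i, j)).
Qed.

Lemma measurable_set1_margin {m n} (t : margin R m n) : measurable [set t].
Proof.
rewrite (_ : [set t] = [set t.1] `*` [set t.2]).
  by apply: measurableX; exact: measurable_set1_matrix.
by case: t => a b; apply/seteqP; split=> [_ -> //|[x y] [/= -> ->]].
Qed.

Lemma measurable_margin_of {m n} : measurable_fun setT (@margin_of R m n).
Proof.
apply: measurable_fun_pair; apply: measurable_fun_matrix => i j.
  under eq_fun do rewrite mxE.
  by apply: measurable_sum => k; exact: measurable_entry.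
under eq_fun do rewrite mxE.
by apply: measurable_sum => k; exact: measurable_entry.
Qed.

Lemma measurable_block {m n} : measurable_fun setT (@block R m n).
Proof.
apply: measurable_fun_matrix => i j.
by under eq_fun do rewrite mxE; exact: measurable_entry.
Qed.

End margin_measurability.

(** On a rational box the integral factors over the entries into integrals of [w i j] over rays;
    finiteness of [Q] extends the equality to all measurable sets. [P] may be infinite. *)
Lemma product_measure_density (R : realType) (m n : nat)
    (f : 'I_m -> 'I_n -> {measure set (measurableTypeR R) -> \bar R})
    (w : 'I_m -> 'I_n -> R -> R) (P Q : {measure set 'M[R]_(m, n) -> \bar R}) :
  (forall i j, measurable_fun setT (w i j)) ->
  (forall i j x, (0 <= w i j x)%R) ->
  is_product_measure f P ->
  is_product_measure (fun i j A => \int[f i j]_(x in A) (w i j x)%:E) Q ->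
  Q setT < +oo ->
  measurable_fun setT
    (fun x : 'M[R]_(m, n) => \prod_i \prod_j w i j (x i j))%R /\
  forall A, measurable A ->
  Q A = \int[P]_(x in A) (\prod_i \prod_j w i j (x i j))%:E.
Proof.
move=> mw w0 fP wQ Qoo.
pose W (x : 'M[R]_(m, n)) := (\prod_i \prod_j w i j (x i j))%R.
have mwE i j : measurable_fun setT (fun x : 'M[R]_(m, n) => w i j (x i j)).
  exact: (measurableT_comp (mw i j) (measurable_entry i j)).
have mW : measurable_fun setT W.
  by apply: measurable_prod => i _; apply: measurable_prod => j _.
have W0 x : (0 <= W x)%R by apply: prodr_ge0 => i _; apply: prodr_ge0 => j _.
split=> // A mA.
apply: (@eq_measure_box R m n Q (density P mW W0)) => //= q.
transitivity (\prod_i \prod_j \int[f i j]_(x in ray (q i j)) (w i j x)%:E).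
  by apply: (wQ (fun i j => ray (q i j))) => i j; exact: measurable_ray.
rewrite /density_measure -integral_indicM.
pose u (ij : 'I_m * 'I_n) x := (\1_(ray (q ij.1 ij.2)) x * w ij.1 ij.2 x)%R.
have := @ge0_integral_prod_coord _ _ _ (measurableTypeR R) R _ P
  (fun (ij : 'I_m * 'I_n) (x : 'M[R]_(m, n)) => x ij.1 ij.2)
  (fun ij => f ij.1 ij.2) _ _ u.
rewrite -(pair_bigA _ (fun i j => \int[f i j]_x (u (i, j) x)%:E))/=.
move=> H; transitivity (\prod_i \prod_j \int[f i j]_x (u (i, j) x)%:E).
  by apply: eq_bigr => i _; apply: eq_bigr => j _; rewrite /u/= integral_indicM.
rewrite -H.
- apply: eq_integral => x _; congr EFin.
  rewrite -(pair_bigA _ (fun i j => u (i, j) (x i j)))/= /W.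
  have -> : \1_(box q) x = (\prod_i \prod_j \1_(ray (q i j)) (x i j))%R :> R.
    rewrite indicE; case: (boolP (_ \in _)) => [/set_mem qx|/negP nqx].
      rewrite big1// => i _; rewrite big1// => j _.
      by rewrite indicE mem_set.
    have /existsNP[i /existsNP[j qx]] : ~ forall i j, ray (q i j) (x i j).
      by move=> qx; apply: nqx; rewrite inE.
    by rewrite (bigD1 i)//= (bigD1 j)//= indicE memNset ?mul0r.
  rewrite -big_split/=; apply: eq_bigr => i _.
  by rewrite -big_split/=; apply: eq_bigr.
- by move=> ij; exact: measurable_entry.
- move=> B mB; transitivity (\prod_p f p.1 p.2 (B (p.1, p.2))); last first.
    by apply: eq_bigr => -[].
  rewrite -(pair_bigA _ (fun i j => f i j (B (i, j))))/=.
  rewrite -(fP (fun i j => B (i, j)))//; congr (P _).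
  apply/seteqP; split=> x Bx; first by move=> i j; exact: (Bx (i, j)).
  by case=> i j; exact: Bx.
- move=> ?; apply: measurable_funM; last exact: mw.
  by apply: measurable_indic; exact: measurable_ray.
- by move=> ? ?; rewrite /u mulr_ge0.
Qed.

Section tilted_law.
Context {R : realType}.
Variable mu : {measure set (measurableTypeR R) -> \bar R}.

Lemma measurable_expR_affine (a b : R) :
  measurable_fun setT (fun x : R => expR (a * x - b)).
Proof.
by apply: measurableT_comp => //; exact: measurable_funB.
Qed.

(** The parameters being sums over a row and a column index, the exponents of the entrywise tilts
    add up to pairings of [ab.1] with the row sums and of [ab.2] with the column sums. *)
Lemma tilted_law_density (m n : nat) (ab : margin R m n)
    (M P : {measure set 'M[R]_(m, n) -> \bar R}) :
  is_product_measure (fun _ _ => mu) M -> is_tilted_law mu ab P ->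
  P setT < +oo ->
  forall A, measurable A ->
    P A = \int[M]_(x in A) (expR (loglik mu (margin_of x) ab))%:E.
Proof.
move=> muM Pab Poo A mA.
pose th i j := (ab.1 0 i + ab.2 0 j)%R.
have [|i j x|_ ->//] := @product_measure_density R m n (fun _ _ => mu)
    (fun i j x => expR (th i j * x - psi mu (th i j))) M P _ _ muM Pab Poo.
- by move=> i j; exact: measurable_expR_affine.
- exact: expR_ge0.
apply: eq_integral => x _; congr EFin.
under eq_bigr do rewrite -expR_sum.
rewrite -expR_sum; congr expR; rewrite /loglik /margin_of/=.
under eq_bigr do rewrite big_split/= sumrN.
rewrite big_split/= sumrN; congr (_ - _)%R.
under eq_bigr do under eq_bigr do rewrite mulrDl.
under eq_bigr do rewrite big_split/=.
rewrite big_split/=; congr (_ + _)%R.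
  apply: eq_bigr => i _.
  by rewrite mxE mulr_suml; under eq_bigr do rewrite mulrC.
rewrite exchange_big/=; apply: eq_bigr => j _.
by rewrite mxE mulr_suml; under eq_bigr do rewrite mulrC.
Qed.

Lemma measurable_loglik (m n : nat) (ab : margin R m n) :
  measurable_fun setT (fun t => loglik mu t ab).
Proof.
have mentry k (i : 'I_k) : measurable_fun setT (fun x : 'rV[R]_k => (x 0 i)%R).
  exact: measurable_entry.
apply: measurable_funB => //; apply: measurable_funD.
  apply: measurable_sum => i; apply: measurable_funM => //.
  exact: (measurableT_comp (mentry _ i) measurable_fst).
apply: measurable_sum => i; apply: measurable_funM => //.
exact: (measurableT_comp (mentry _ i) measurable_snd).
Qed.

End tilted_law.

(** * Continuity of the log-Laplace transform *)

Section psi_regularity.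
Context {R : realType}.
Variable mu : {measure set (measurableTypeR R) -> \bar R}.

Definition tilt_measure (th : R) :
    {measure set (measurableTypeR R) -> \bar R} :=
  density mu (measurable_expR_affine th (psi mu th)) (fun=> expR_ge0 _).

Lemma measurable_expR_scale (th : R) :
  measurable_fun setT (fun x : R => expR (th * x)).
Proof. exact: measurableT_comp. Qed.

Lemma tilt_setTE (th : R) :
  tilt mu th setT = (expR (- psi mu th))%:E * laplace mu th.
Proof.
rewrite /tilt /laplace -ge0_integralZl ?lee_fin ?expR_ge0//.
- by apply: eq_integral => x _; rewrite addrC expRD EFinM.
- by apply/measurable_EFinP; exact: measurable_expR_scale.
Qed.

Lemma laplace_ge0 th : 0 <= laplace mu th.
Proof. by apply: integral_ge0 => x _; rewrite lee_fin expR_ge0. Qed.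

(** A nonzero tilt rules out a vanishing transform, at which [ln] in [psi] would return a default
    value. *)
Lemma laplace_fine_gt0 th : Theta mu th -> tilt mu th setT != 0 ->
  (0 < fine (laplace mu th))%R.
Proof.
move=> th_fin tilt_neq0; rewrite fine_gt0// th_fin andbT lt0e laplace_ge0 andbT.
by apply: contraNneq tilt_neq0; rewrite tilt_setTE => ->; rewrite mule0.
Qed.

Lemma tilt_setT th : Theta mu th -> tilt mu th setT != 0 -> tilt mu th setT = 1.
Proof.
move=> th_fin /(laplace_fine_gt0 th_fin) L_gt0.
rewrite tilt_setTE expRN /psi lnK ?posrE//.
rewrite -[X in _ * X]fineK; last by rewrite ge0_fin_numE// laplace_ge0.
by rewrite -EFinM mulVf// gt_eqF.
Qed.

Lemma tilt_tilt (th th0 : R) A : measurable A ->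
  tilt mu th A = \int[tilt_measure th0]_(x in A)
    (expR ((th - th0) * x - (psi mu th - psi mu th0)))%:E.
Proof.
move=> mA; rewrite (@ge0_integral_density_in _ _ _ mu (tilt_measure th0)
  (fun x => expR (th0 * x - psi mu th0)))//.
- apply: eq_integral => x _; rewrite -EFinM -expRD; congr (expR _)%:E.
  by ring.
- exact: measurable_expR_affine.
- by apply/measurable_EFinP; exact: measurable_expR_affine.
Qed.

Lemma integrable_expR_scale th : Theta mu th ->
  mu.-integrable setT (fun x => (expR (th * x))%:E).
Proof.
move=> th_fin; apply/integrableP; split.
  by apply/measurable_EFinP; exact: measurable_expR_scale.
by under eq_integral => x _ do rewrite gee0_abs ?lee_fin ?expR_ge0//.
Qed.

(** Dominated convergence: for [t] between [u] and [v], [expR (t * x)] is at most its value at [u]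
    or at [v], according to the sign of [x], hence at most their sum. *)
Lemma continuous_laplace (th : R) : (Theta mu)° th ->
  {for th, continuous (fun t => fine (laplace mu t))}.
Proof.
move=> /nbhs_ballP[e /= e0 eTheta].
(* Half the radius keeps both endpoints inside the ball contained in [Theta]. *)
pose u := (th - e / 2)%R; pose v := (th + e / 2)%R.
have in_Theta t : (u <= t <= v)%R -> Theta mu t.
  move=> /andP[ut tv]; apply: eTheta; rewrite /ball/= ltr_distlC.
  by move: ut tv; rewrite /u /v => ut tv; apply/andP; split; lra.
have uv : (u <= v)%R by rewrite /u /v; lra.
have := @continuity_under_integral R _ (measurableTypeR R) mu
  (fun t x => expR (t * x)) setT measurableT u v _ _
  (fun x => expR (u * x) + expR (v * x))%R.
move=> H; apply: H.
- move=> t /=; rewrite in_itv/= => /andP[ut tv].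
  by apply: integrable_expR_scale; apply: in_Theta; rewrite !ltW.
- apply: aeW => x _ t _.
  by apply: continuous_comp; [exact: mulrr_continuous|exact: continuous_expR].
- rewrite (_ : EFin \o _ = (fun x => (expR (u * x))%:E) \+
    (fun x => (expR (v * x))%:E))//; apply: integrableD => //.
    by apply: integrable_expR_scale; apply: in_Theta; rewrite lexx.
  by apply: integrable_expR_scale; apply: in_Theta; rewrite lexx andbT.
- move=> t /=; rewrite in_itv/= => /andP[ut tv]; apply: aeW => x _.
  rewrite ger0_norm ?expR_ge0//; have [x0|x0] := leP 0%R x.
    rewrite -[leLHS]add0r lerD ?expR_ge0// ler_expR ler_wpM2r//.
    exact: ltW.
  rewrite -[leLHS]addr0 lerD ?expR_ge0// ler_expR ler_wnM2r//; exact: ltW.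
- by rewrite inE/= in_itv/= /u /v; apply/andP; split; lra.
Qed.

Lemma continuous_psi (th : R) : (Theta mu)° th -> tilt mu th setT != 0 ->
  {for th, continuous (psi mu)}.
Proof.
move=> Hth tilt_neq0; apply: continuous_comp; first exact: continuous_laplace.
apply: continuous_ln; apply: laplace_fine_gt0 => //.
exact: interior_subset.
Qed.

End psi_regularity.

(** * The law of the block and its change with the parameter *)

Section tilted_block.
Context {R : realType} {m n : nat}.
Variable mu : {measure set (measurableTypeR R) -> \bar R}.
Implicit Types (ab : margin R m.+1 n.+1)
  (P : probability 'M[R]_(m.+1, n.+1) R).

(** A vanishing factor would annihilate the total mass 1 of [P]; this is how a zero [mu] is
    excluded. *)
Lemma tilted_law_tilt_neq0 ab P : is_tilted_law mu ab P ->
  forall i j, tilt mu (ab.1 0 i + ab.2 0 j)%R setT != 0.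
Proof.
move=> Pab; pose F i j := tilt mu (ab.1 0 i + ab.2 0 j)%R setT.
have F1 : \prod_i \prod_j F i j = 1.
  transitivity (P [set x | forall i j, [set: R] (x i j)]).
    exact/esym/(Pab (fun _ _ => setT))/(fun _ _ => measurableT).
  rewrite (_ : [set _ | _] = setT); last by apply/seteqP; split.
  exact: probability_setT.
move=> i j; rewrite -/(F i j); apply: contra_eq_neq F1.
move: (F) => G G0; rewrite (bigD1 i)//= (bigD1 j)//= G0 !mul0e.
by rewrite eq_sym onee_neq0.
Qed.

(** A product set for the block is one for the full matrix with the whole line in the last row and
    column, where the factors are 1 because the tilts are probabilities. *)
Lemma tilted_law_block ab P : admissible mu ab -> is_tilted_law mu ab P ->
  is_product_measure (fun (i : 'I_m) (j : 'I_n) =>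
      tilt mu (ab.1 0 (widen_ord (leqnSn m) i)
               + ab.2 0 (widen_ord (leqnSn n) j))%R)
    (pushforward P block).
Proof.
move=> adm Pab A mA.
have tilt1 i j : tilt mu (ab.1 0 i + ab.2 0 j)%R setT = 1.
  apply: tilt_setT; last exact: (tilted_law_tilt_neq0 Pab).
  exact: interior_subset (adm i j).
(* [insub] fails exactly at the last index, so the last row and column receive [setT]. *)
pose A' (i : 'I_m.+1) (j : 'I_n.+1) :=
  if insub (val i) is Some k then
    if insub (val j) is Some l then A k l else setT
  else setT.
have A'E i j : A' (widen_ord (leqnSn m) i) (widen_ord (leqnSn n) j) = A i j.
  by rewrite /A'/= !valK.
have A'mr i j : A' ord_max i = setT /\ A' j ord_max = setT.
  rewrite /A'/= insubF ?ltnn//; split=> //.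
  by rewrite [insub n]insubF ?ltnn//; case: insub.
have mA' i j : measurable (A' i j).
  by rewrite /A'; case: insub => // k; case: insub.
transitivity (P [set x | forall i j, A' i j (x i j)]).
  rewrite /pushforward; congr (P _); apply/seteqP; split=> x /= Ax.
    move=> i j; rewrite /A'.
    case: insubP => // k _ ki; case: insubP => // l _ lj.
    have := Ax k l; rewrite mxE.
    by congr (A k l (x _ _)); apply/val_inj.
  by move=> i j; rewrite mxE -A'E.
rewrite Pab// big_ord_recr/= [X in _ * X]big1 ?mule1; last first.
  by move=> j _; rewrite (A'mr j ord0).1 tilt1.
apply: eq_bigr => i _; rewrite big_ord_recr/= (A'mr ord0 _).2 tilt1 mule1.
by apply: eq_bigr => j _; rewrite A'E.
Qed.

(* The density of the law of [block Y_ab] with respect to that of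
   [block Y_ab0]. *)
Definition block_ratio (ab0 ab : margin R m.+1 n.+1) (y : 'M[R]_(m, n)) : R :=
  (\prod_i \prod_j
    let th := ab.1 0 (widen_ord (leqnSn m) i)
              + ab.2 0 (widen_ord (leqnSn n) j) in
    let th0 := ab0.1 0 (widen_ord (leqnSn m) i)
               + ab0.2 0 (widen_ord (leqnSn n) j) in
    expR ((th - th0) * y i j - (psi mu th - psi mu th0)))%R.

Lemma block_ratio_ge0 ab0 ab y : (0 <= block_ratio ab0 ab y)%R.
Proof.
by apply: prodr_ge0 => i _; apply: prodr_ge0 => j _; exact: expR_ge0.
Qed.

Lemma block_density ab0 ab P0 P : admissible mu ab0 -> admissible mu ab ->
  is_tilted_law mu ab0 P0 -> is_tilted_law mu ab P ->
  measurable_fun setT (block_ratio ab0 ab) /\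
  forall B, measurable B ->
    pushforward P block B =
    \int[pushforward P0 block]_(y in B) (block_ratio ab0 ab y)%:E.
Proof.
move=> adm0 adm P0ab Pab.
have K0 := tilted_law_block adm0 P0ab; have K := tilted_law_block adm Pab.
pose th (ab : margin R m.+1 n.+1) (i : 'I_m) (j : 'I_n) : R :=
  (ab.1 0 (widen_ord (leqnSn m) i) + ab.2 0 (widen_ord (leqnSn n) j))%R.
apply: (@product_measure_density R m n (fun i j => tilt_measure mu (th ab0 i j))
  (fun i j x => expR ((th ab i j - th ab0 i j) * x -
     (psi mu (th ab i j) - psi mu (th ab0 i j))))%R
  (image_measure P0 measurable_block) (image_measure P measurable_block)).
- by move=> i j; exact: measurable_expR_affine.
- by move=> i j x; exact: expR_ge0.
- exact: K0.
- move=> A mA; rewrite /image_measure/= K//.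
  by apply: eq_bigr => i _; apply: eq_bigr => j _; exact: tilt_tilt.
- by rewrite /image_measure/= /pushforward preimage_setT probability_setT ltry.
Qed.

End tilted_block.

(** * Continuity in the parameter *)

Definition rational_margin {R : realType} {m n : nat} (q : margin rat m n) :
  margin R m n := (map_mx ratr q.1, map_mx ratr q.2).

Section parameter_space.
Context {R : realType} {m n : nat}.
Variable mu : {measure set (measurableTypeR R) -> \bar R}.

Lemma rational_row_near k (a : 'rV[R]_k) (e : R) : (0 < e)%R ->
  exists q : 'rV[rat]_k, ball a e (map_mx ratr q).
Proof.
move=> e0.
have /choice[q qe] j : exists q : rat, ball (a 0%R j) e (ratr q : R).
  have ae : (a 0 j < a 0 j + e)%R by rewrite ltrDl.
  have [q] := rat_in_itvoo ae; rewrite in_itv/= => /andP[aq qae]; exists q.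
  by rewrite /ball/= ltr_distlC; apply/andP; split; lra.
exists (\row_j q j); split=> // i j.
by rewrite !mxE ord1; exact: qe.
Qed.

Lemma rational_margin_near (ab : margin R m n) (U : set (margin R m n)) :
  nbhs ab U -> exists q, U (rational_margin q).
Proof.
move=> /nbhs_ballP[e /= e0 eU].
have [q1 q1e] := rational_row_near ab.1 e0.
have [q2 q2e] := rational_row_near ab.2 e0.
by exists (q1, q2); apply: eU.
Qed.

Lemma continuous_margin_sum (i : 'I_m) (j : 'I_n) :
  continuous (fun ab : margin R m n => ab.1 0 i + ab.2 0 j)%R.
Proof.
move=> ab; apply: cvgD.
  apply: (@continuous_comp _ _ _ fst (fun x : 'rV[R]_m => x 0%R i)).
    exact: cvg_fst.
  exact: coord_continuous.
apply: (@continuous_comp _ _ _ snd (fun x : 'rV[R]_n => x 0%R j)).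
  exact: cvg_snd.
exact: coord_continuous.
Qed.

Lemma nbhs_admissible (ab : margin R m n) :
  admissible mu ab -> nbhs ab (admissible mu : set (margin R m n)).
Proof.
move=> adm.
apply: (@filter_forall _ _ (fun (i : 'I_m) (x : margin R m n) =>
  forall j, (Theta mu)° (x.1 0 i + x.2 0 j)%R) _ (nbhs_filter ab)) => i.
apply: (@filter_forall _ _ (fun (j : 'I_n) (x : margin R m n) =>
  (Theta mu)° (x.1 0 i + x.2 0 j)%R) _ (nbhs_filter ab)) => j.
have := @continuous_margin_sum i j ab (Theta mu)°; apply.
by apply: open_nbhs_nbhs; split; [exact: open_interior|exact: adm].
Qed.

(** Rational parameters are dense in the open set of admissible ones, so any neighborhoods of [f ab]
    and of [c] share the point [c], and separation concludes. *)
Lemma eq_cst_on_admissible (V : topologicalType) (f : margin R m n -> V)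
    (c : V) :
  hausdorff_space V ->
  {within admissible mu, continuous f} ->
  (forall q, admissible mu (@rational_margin R m n q) ->
    f (rational_margin q) = c) ->
  forall ab, admissible mu ab -> f ab = c.
Proof.
move=> hV /subspace_continuousP cf fc ab adm; apply: hV => A B nA nB.
have nA' : nbhs ab [set x | admissible mu x -> A (f x)] := cf _ adm A nA.
have nab : nbhs ab [set x | admissible mu x /\ A (f x)].
  apply: (@filterS _ (nbhs ab) (nbhs_filter ab)
    (admissible mu `&` [set x | admissible mu x -> A (f x)])).
    by move=> x [admx /(_ admx)].
  by apply: filterI => //; exact: nbhs_admissible.
have [q [admq Aq]] := rational_margin_near nab.
exists (f (rational_margin q)); split => //; rewrite fc//.
exact: nbhs_singleton.
Qed.

End parameter_space.

Section block_ratio_continuity.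
Context {R : realType} {m n : nat}.
Variable mu : {measure set (measurableTypeR R) -> \bar R}.

(** The product is the exponential of a finite sum; the law [P] supplies the nonzero tilts that make
    [psi] continuous at each entry's parameter. *)
Lemma continuous_block_ratio (ab0 ab : margin R m.+1 n.+1)
    (P : probability 'M[R]_(m.+1, n.+1) R) (y : 'M[R]_(m, n)) :
  admissible mu ab -> is_tilted_law mu ab P ->
  {for ab, continuous (fun ab' => block_ratio mu ab0 ab' y)}.
Proof.
move=> adm Pab.
pose th (ab : margin R m.+1 n.+1) (i : 'I_m) (j : 'I_n) : R :=
  (ab.1 0 (widen_ord (leqnSn m) i) + ab.2 0 (widen_ord (leqnSn n) j))%R.
rewrite (_ : (fun ab' => _) = fun ab' =>
  expR (\sum_i \sum_j ((th ab' i j - th ab0 i j) * y i j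
    - (psi mu (th ab' i j) - psi mu (th ab0 i j))))); last first.
  apply/funext => ab'; rewrite expR_sum; apply: eq_bigr => i _.
  by rewrite expR_sum.
apply: continuous_comp; last exact: continuous_expR.
apply: (@cvg_big _ _ +%R) => [|i _]; first exact: add_continuous.
apply: (@cvg_big _ _ +%R) => [|j _]; first exact: add_continuous.
have cth : {for ab, continuous (fun ab' => th ab' i j)}.
  exact: continuous_margin_sum.
apply: cvgB.
  by apply: cvgMr_tmp; apply: cvgB => //; exact: cvg_cst.
apply: cvgB; last exact: cvg_cst.
apply: (continuous_comp (f := fun ab' => th ab' i j) (g := psi mu)) => //.
by apply: continuous_psi; [exact: adm|exact: (tilted_law_tilt_neq0 Pab)].
Qed.

End block_ratio_continuity.

(** * The conclusions for almost every margin *)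

Section conclusion.
Context {R : realType} {m n : nat}.
Variable mu : {measure set (measurableTypeR R) -> \bar R}.
Variables (M : {measure set 'M[R]_(m.+1, n.+1) -> \bar R})
  (HM : is_product_measure (fun _ _ => mu) M)
  (lam : margin R m.+1 n.+1 -> {measure set 'M[R]_(m.+1, n.+1) -> \bar R})
  (Hlam : disintegration M margin_of lam)
  (Y : margin R m.+1 n.+1 -> probability 'M[R]_(m.+1, n.+1) R)
  (HY : forall ab, admissible mu ab -> is_tilted_law mu ab (Y ab)).

Let Y_density ab : admissible mu ab -> forall A, measurable A ->
  Y ab A = \int[M]_(x in A) (expR (loglik mu (margin_of x) ab))%:E.
Proof.
move=> adm A mA; apply: (tilted_law_density HM (HY adm)) => //.
by apply: (le_lt_trans _ (ltry 1)); exact: probability_le1.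
Qed.

Let measurable_margin_density ab :
  measurable_fun setT (fun t : margin R m.+1 n.+1 => expR (loglik mu t ab)).
Proof. by apply: measurableT_comp => //; exact: measurable_loglik. Qed.

Let tilted_disintegration ab :
  admissible mu ab -> disintegration (Y ab) margin_of lam.
Proof.
move=> adm; apply: (disintegration_density measurable_margin_of
  measurable_set1_margin (measurable_margin_density ab) _ (Y_density adm) Hlam).
by move=> t; exact: expR_gt0.
Qed.

(** The margin law of [Y ab] has a positive density with respect to the image of [M], so its null
    sets are null for that image too. *)
Let ae_margin ab (Q : margin R m.+1 n.+1 -> Prop) : admissible mu ab ->
  {ae pushforward (Y ab) margin_of, forall t, Q t} ->
  {ae pushforward M margin_of, forall t, Q t}.
Proof.
move=> adm.
have G0 t : (0 < expR (loglik mu t ab))%R by exact: expR_gt0.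
have NE := image_measure_density measurable_margin_of
  (measurable_margin_density ab) (fun t => ltW (G0 t)) (Y_density adm).
by have [_] := density_ae (measurable_margin_density ab) G0 NE Q.
Qed.

Let ae_lam_setT : {ae pushforward M margin_of, forall t, lam t setT = 1}.
Proof. by case: Hlam. Qed.

Section conditional_law.
Variables (eta : margin R m.+1 n.+1 -> margin R m.+1 n.+1 ->
  {measure set 'M[R]_(m.+1, n.+1) -> \bar R}).
Hypothesis Heta : forall ab, admissible mu ab ->
  disintegration (Y ab) margin_of (eta ab).

Lemma conditional_law_ae ab : admissible mu ab ->
  {ae pushforward M margin_of, forall t, same_law (lam t) (eta ab t)}.
Proof.
move=> adm; apply: (ae_margin adm).
exact: (disintegration_matrix_unique measurable_margin_of measurable_set1_margin
  (tilted_disintegration adm) (Heta adm)).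
Qed.

Lemma conditional_law_ae_all :
  (forall t A, measurable A ->
     {within admissible mu, continuous (fun ab => eta ab t A)}) ->
  {ae pushforward M margin_of, forall t,
     forall ab, admissible mu ab -> same_law (lam t) (eta ab t)}.
Proof.
move=> ceta.
have H : {ae image_measure M measurable_margin_of, forall t, forall q,
    admissible mu (@rational_margin R m.+1 n.+1 q) ->
    same_law (lam t) (eta (rational_margin q) t)}.
  apply: ae_forall_countable => q.
  have [adm|nadm] := pselect (admissible mu (@rational_margin R m.+1 n.+1 q)).
    apply: (ae_image measurable_margin_of) (conditional_law_ae adm).
    by move=> t Ht _.
  by apply: aeW.
apply: (ae_image measurable_margin_of) H.
move=> t Hq ab adm A mA; apply/esym.
(* As a function of the parameter, [eta ab t A] is continuous and equals [lam t A] at every rational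
   admissible parameter. *)
apply: (eq_cst_on_admissible (@ereal_hausdorff R) (ceta t A mA)) adm => q admq.
by rewrite (Hq q admq).
Qed.

End conditional_law.

Section block_law.
Variables (kappa : margin R m.+1 n.+1 ->
             R.-pker 'M[R]_(m, n) ~> margin R m.+1 n.+1)
  (p : margin R m.+1 n.+1 -> 'M[R]_(m, n) -> margin R m.+1 n.+1 -> R).
Hypothesis Hp : forall ab, admissible mu ab ->
  is_cond_law (Y ab) block margin_of (kappa ab) /\
  is_margin_density (Y ab) (kappa ab) (p ab).

Let p_ge0 ab : admissible mu ab -> forall y t, (0 <= p ab y t)%R.
Proof. by move=> /Hp[_ []]. Qed.

Let measurable_p ab t : admissible mu ab -> measurable_fun setT (p ab ^~ t).
Proof. by move=> /Hp[_ [_ mp _]]; exact: (measurable_fun_pair1 t mp). Qed.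

(** Conditioning on the block writes the joint law as an integral of [kappa ab], and the density of
    [kappa ab] turns this into a double integral of [p ab]. *)
Lemma block_law_ae ab : admissible mu ab ->
  {ae pushforward M margin_of, forall t, forall A, measurable A ->
    lam t (block @^-1` A) =
    \int[pushforward (Y ab) block]_(y in A) (p ab y t)%:E}.
Proof.
move=> adm; apply: (ae_margin adm).
have [YK [p0 mp kE]] := Hp adm.
apply: (disintegration_joint_density measurable_block measurable_margin_of
  measurable_set1_margin (tilted_disintegration adm) mp p0) => A E mA mE.
have -> : block @^-1` A `&` margin_of @^-1` E =
  [set x | A (block x) /\ E (margin_of x)] by [].
rewrite YK//.
pose N : {mfun 'M[R]_(m.+1, n.+1) >-> margin R m.+1 n.+1} :=
  HB.pack (@margin_of R m.+1 n.+1)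
    (isMeasurableFun.Build _ _ _ _ _ measurable_margin_of).
pose K : {mfun 'M[R]_(m.+1, n.+1) >-> 'M[R]_(m, n)} :=
  HB.pack (@block R m n) (isMeasurableFun.Build _ _ _ _ _ measurable_block).
have [mpN _ _] := @fubini_tonelli_in _ _ _ _ _ (distribution (Y ab) K)
  (distribution (Y ab) N) _ _ _ mp p0 mA mE.
apply: (@ge0_ae_eq_integral _ _ _
  (image_measure (Y ab) measurable_block)) => //.
- apply: measurable_funTS; exact: (measurable_kernel (kappa ab) E mE).
- apply: measurable_funTS; exact: mpN.
- move=> y _; apply: (@integral_ge0 _ _ _
    (image_measure (Y ab) measurable_margin_of)) => t _.
  by rewrite lee_fin p0.
apply: (ae_image measurable_block) kE.
by move=> y /= yE _; exact: (yE E mE).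
Qed.

Let comparison t ab : admissible mu ab -> lam t setT = 1 ->
  (forall A, measurable A -> lam t (block @^-1` A) =
    \int[pushforward (Y ab) block]_(y in A) (p ab y t)%:E) ->
  block_comparison (lam t) (Y ab) (fun y => p ab y t).
Proof.
move=> adm lam1 lamE.
exact: (block_comparison_density measurable_block (measurable_p t adm)
  (fun y => p_ge0 adm y t) lam1 lamE).
Qed.

Lemma block_comparison_ae ab : admissible mu ab ->
  {ae pushforward M margin_of, forall t,
    block_comparison (lam t) (Y ab) (fun y => p ab y t)}.
Proof.
move=> adm; apply: (ae_image2 measurable_margin_of _ ae_lam_setT
  (block_law_ae adm)).
by move=> t lam1; exact: comparison.
Qed.

(** For different [ab] the functions [p ab] are densities with respect to different laws;
    multiplying by [block_ratio] refers them all to one law before continuity is used. *)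
Lemma block_comparison_ae_all :
  (forall y t, {within admissible mu, continuous (fun ab => p ab y t)}) ->
  {ae pushforward M margin_of, forall t, forall ab, admissible mu ab ->
    block_comparison (lam t) (Y ab) (fun y => p ab y t)}.
Proof.
move=> cp.
have H : {ae image_measure M measurable_margin_of, forall t, forall q,
    admissible mu (@rational_margin R m.+1 n.+1 q) ->
    forall A, measurable A -> lam t (block @^-1` A) =
    \int[pushforward (Y (rational_margin q)) block]_(y in A)
      (p (rational_margin q) y t)%:E}.
  apply: ae_forall_countable => q.
  have [adm|nadm] := pselect (admissible mu (@rational_margin R m.+1 n.+1 q)).
    apply: (ae_image measurable_margin_of) (block_law_ae adm).
    by move=> t Ht _.
  by apply: aeW.
apply: (ae_image2 measurable_margin_of _ ae_lam_setT H).
move=> t lam1 lamq ab adm; apply: comparison => // A mA.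
(* Admissible parameters form an open set, so a rational one exists; its block law is the
   reference. *)
have [q0 adm0] := rational_margin_near (nbhs_admissible adm).
pose ab0 : margin R m.+1 n.+1 := rational_margin q0.
pose K0 := image_measure (Y ab0) measurable_block.
pose r ab y := block_ratio mu ab0 ab y.
have KE ab' (adm' : admissible mu ab') (B : set 'M[R]_(m, n)) : measurable B ->
    \int[pushforward (Y ab') block]_(y in B) (p ab' y t)%:E =
    \int[K0]_(y in B) (p ab' y t * r ab' y)%:E.
  move=> mB; have [mr rE] := block_density adm0 adm' (HY adm0) (HY adm').
  rewrite (@ge0_integral_density_in _ _ _ K0
    (image_measure (Y ab') measurable_block) (r ab'))//.
  - by move=> y; exact: block_ratio_ge0.
  - by apply/measurable_EFinP; exact: measurable_p.
  - by move=> y; rewrite lee_fin p_ge0.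
have mpr ab' : admissible mu ab' ->
    measurable_fun setT (fun y => p ab' y t * r ab' y)%R.
  move=> adm'; have [mr _] := block_density adm0 adm' (HY adm0) (HY adm').
  by apply: measurable_funM => //; exact: measurable_p.
have pr0 ab' y : admissible mu ab' -> (0 <= p ab' y t * r ab' y)%R.
  by move=> adm'; rewrite mulr_ge0 ?p_ge0 ?block_ratio_ge0.
(* At rational parameters the products are all densities, with respect to [K0], of the law of the
   block under [lam t], as is [p ab0]. *)
have aeq : {ae K0, forall y, forall q,
    admissible mu (@rational_margin R m.+1 n.+1 q) ->
    (p (rational_margin q) y t * r (rational_margin q) y = p ab0 y t)%R}.
  apply: ae_forall_countable => q.
  have [admq|nadm] := pselect (admissible mu (@rational_margin R m.+1 n.+1 q));
    last exact: aeW.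
  have : {ae K0, forall y,
      (p (rational_margin q) y t * r (rational_margin q) y)%:E
      = (p ab0 y t)%:E}.
    apply: ge0_integral_ae_eq.
    - by apply/measurable_EFinP; exact: mpr.
    - by apply/measurable_EFinP; exact: measurable_p.
    - by move=> y; rewrite lee_fin pr0.
    - rewrite -KE// -lamq// preimage_setT lam1; exact: ltry.
    - by move=> E mE; rewrite -KE// -lamq// -lamq.
  by apply: filterS => y [yE] _.
rewrite (lamq q0 adm0)// [RHS]KE//.
apply: (@ge0_ae_eq_integral _ _ _ K0) => //.
- by apply/measurable_funTS/measurable_EFinP; exact: measurable_p.
- by apply/measurable_funTS/measurable_EFinP; exact: mpr.
- by move=> y _; rewrite lee_fin p_ge0.
- by move=> y _; rewrite lee_fin pr0.
(* Off the null set [y] is fixed, and the product is continuous in the parameter and constant on the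
   rational ones. *)
apply: filterS aeq => y yq _; congr EFin; apply/esym.
apply: (@eq_cst_on_admissible _ _ _ mu _
  (fun ab' => p ab' y t * r ab' y)%R) yq _ adm => //.
apply/subspace_continuousP => ab' adm'; apply: cvgM.
  by have /subspace_continuousP := cp y t; exact.
apply: cvg_within_filter.
exact: (continuous_block_ratio adm' (HY adm')).
Qed.

End block_law.

End conclusion.

Unset Implicit Arguments.
Set Strict Implicit.

Theorem theorem1p11 (R : realType)
  (mu : {sigma_finite_measure set (measurableTypeR R) -> \bar R})
  (HTheta : exists theta1 theta2 : R,
      [/\ Theta mu theta1, Theta mu theta2 & theta1 <> theta2])
  (m n : nat) (rho : R) (Hrho : (0 <= rho)%R)
  (M : {measure set 'M[R]_(m.+1, n.+1) -> \bar R})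
  (HM : is_product_measure (fun _ _ => mu) M)
  (Hnu : sigma_finite setT (pushforward M margin_of))
  (lam : margin R m.+1 n.+1 -> {measure set 'M[R]_(m.+1, n.+1) -> \bar R})
  (Hlam : disintegration M margin_of lam)
  (* ab = (alpha, beta), and Y ab is the law of the random matrix *)
  (Y : margin R m.+1 n.+1 -> probability 'M[R]_(m.+1, n.+1) R)
  (HY : forall ab, admissible mu ab -> is_tilted_law mu ab (Y ab)) :
  (* eta ab is a version of the conditional law of Y ab given its margin.
     First at a fixed parameter with arbitrary versions; then at the MLE of
     the margin itself, which moves with t, so that the versions for
     different parameters must be tied together: they vary continuously
     with the parameter. *)
  (forall eta : margin R m.+1 n.+1 -> margin R m.+1 n.+1 ->
        {measure set 'M[R]_(m.+1, n.+1) -> \bar R},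
    (forall ab, admissible mu ab ->
       disintegration (Y ab) margin_of (eta ab)) ->
    (forall ab, admissible mu ab ->
       {ae pushforward M margin_of, forall t,
          rho = 0%R \/ M (transport rho t) = 0 ->
          same_law (lam t) (eta ab t)}) /\
    ((forall t A, measurable A ->
        {within admissible mu, continuous (fun ab => eta ab t A)}) ->
     {ae pushforward M margin_of, forall t,
        rho = 0%R \/ M (transport rho t) = 0 ->
        forall ab, is_MLE mu t ab -> same_law (lam t) (eta ab t)})) /\
  (* kappa ab y is nu_y and p ab y its density p_y, for Y ab; again first at
     a fixed parameter, then at the MLE of the margin. *)
  (forall (kappa : margin R m.+1 n.+1 ->
             R.-pker 'M[R]_(m, n) ~> margin R m.+1 n.+1)
          (p : margin R m.+1 n.+1 -> 'M[R]_(m, n) -> margin R m.+1 n.+1 -> R),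
    (forall ab, admissible mu ab ->
       is_cond_law (Y ab) block margin_of (kappa ab) /\
       is_margin_density (Y ab) (kappa ab) (p ab)) ->
    (forall ab, admissible mu ab ->
       {ae pushforward M margin_of, forall t,
          rho = 0%R \/ M (transport rho t) = 0 ->
          block_comparison (lam t) (Y ab) (fun y => p ab y t)}) /\
    ((forall y t,
        {within admissible mu, continuous (fun ab => p ab y t)}) ->
     {ae pushforward M margin_of, forall t,
        rho = 0%R \/ M (transport rho t) = 0 ->
        forall ab, is_MLE mu t ab ->
          block_comparison (lam t) (Y ab) (fun y => p ab y t)})).
Proof.
split=> [eta Heta|kappa p Hp]; split.
- move=> ab adm.
  apply: (ae_image measurable_margin_of)
    (conditional_law_ae HM Hlam HY Heta adm).
  by move=> t Ht _.
- move=> ceta.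
  apply: (ae_image measurable_margin_of)
    (conditional_law_ae_all HM Hlam HY Heta ceta).
  by move=> t Ht _ ab [adm _]; exact: Ht.
- move=> ab adm.
  apply: (ae_image measurable_margin_of)
    (block_comparison_ae HM Hlam HY Hp adm).
  by move=> t Ht _.
- move=> cp.
  apply: (ae_image measurable_margin_of)
    (block_comparison_ae_all HM Hlam HY Hp cp).
  by move=> t Ht _ ab [adm _]; exact: Ht.
Qed.
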